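(* Let $k,\ell,n$ be positive integers, let $\sigma\in S_n$ and let $(P,Q)$ be the pair of standard Young tableaux corresponding to $\sigma$ under the RSK correspondence. Then $\sigma$ is $(k,\ell)$-top-right-crucial if and only if all of the following hold: (1) the number of columns in $P$ (and $Q$) is $k-1$; (2) the number of rows in $P$ (and $Q$) is $\ell-1$; (3) $P$ contains an increasing sequence of elements $p_{1,k-1}<p_{2,j_2}<\cdots<p_{\ell-1,j_{\ell-1}}$ for some column indices $j_2,\ldots,j_{\ell-1}$; (4) $Q$ contains an increasing sequence of elements $q_{1,k-1}<q_{2,j'_2}<\cdots<q_{\ell-1,j'_{\ell-1}}$ for some column indices $j'_2,\ldots,j'_{\ell-1}$.
   Context: $S_n$ is the set of permutations $\sigma=\sigma_1\cdots\sigma_n$ of $\{1,\ldots,n\}$ in one-line notation. The patterns $12\cdots m$ and $m(m-1)\cdots 1$ are denoted $i_m$ and $d_m$; a permutation contains $i_m$ (resp. $d_m$) if it has an increasing (resp. decreasing) subsequence of length $m$, and avoids it otherwise. The extensions of $\sigma\in S_n$ to the right are the permutations $e_t(\sigma_1)\cdots e_t(\sigma_n)\,t$, $1\le t\le n+1$, where $e_t(x)=x$ if $x<t$ and $e_t(x)=x+1$ if $x\ge t$. The extensions of $\sigma$ from above are the $n+1$ permutations $\sigma_1\cdots\sigma_{t-1}(n+1)\sigma_t\cdots\sigma_n$, $1\le t\le n+1$. A permutation is $(k,\ell)$-top-right-crucial if it avoids $i_k$ and $d_\ell$ but each of its extensions to the right and each of its extensions from above contains $i_k$ or $d_\ell$.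 RSK: $P$ is the insertion tableau obtained by row-inserting $\sigma_1,\ldots,\sigma_n$ successively into the empty tableau, and $Q$ is the recording tableau. $p_{i,j}$ and $q_{i,j}$ denote the entries of $P$ and $Q$ in row $i$ (from the top) and column $j$ (from the left). *)

(* Defs.v *)
From mathcomp Require Import all_boot all_fingroup.

Set Implicit Arguments.
Unset Strict Implicit.
Unset Printing Implicit Defensive.

(* Since 'I_n is {0, .., n - 1}, values are shifted by one to obtain words on
   {1, .., n}. *)
Definition one_line (n : nat) (sigma : 'S_n) : seq nat :=
  [seq (val (sigma i)).+1 | i <- enum 'I_n].

Definition contains_inc (m : nat) (w : seq nat) : Prop :=
  exists s : seq nat, [/\ subseq s w, size s = m & sorted ltn s].

Definition contains_dec (m : nat) (w : seq nat) : Prop :=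
  exists s : seq nat, [/\ subseq s w, size s = m & sorted gtn s].

Definition shift_from (t x : nat) : nat := if x < t then x else x.+1.

Definition ext_right (w : seq nat) (t : nat) : seq nat :=
  rcons [seq shift_from t x | x <- w] t.

Definition ext_above (w : seq nat) (t : nat) : seq nat :=
  take t.-1 w ++ (size w).+1 :: drop t.-1 w.

Definition top_right_crucial (k l n : nat) (sigma : 'S_n) : Prop :=
  let w := one_line sigma in
  [/\ ~ contains_inc k w, ~ contains_dec l w,
      forall t, 1 <= t <= n.+1 ->
        contains_inc k (ext_right w t) \/ contains_dec l (ext_right w t)
    & forall t, 1 <= t <= n.+1 ->
        contains_inc k (ext_above w t) \/ contains_dec l (ext_above w t)].

(* A tableau is the sequence of its rows, from top to bottom. *)
Definition tableau := seq (seq nat).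

(* The second component is the entry bumped by x, or None if x was appended
   at the end of the row. *)
Fixpoint row_insert (x : nat) (r : seq nat) : seq nat * option nat :=
  match r with
  | [::] => ([:: x], None)
  | y :: r' =>
      if x < y then (x :: r', Some y)
      else let: (r'', b) := row_insert x r' in (y :: r'', b)
  end.

(* The second component is the 0-based index of the row in which the new box
   was created. *)
Fixpoint tab_insert (x : nat) (T : tableau) : tableau * nat :=
  match T with
  | [::] => ([:: [:: x]], 0)
  | r :: T' =>
      match row_insert x r with
      | (r', None) => (r' :: T', 0)
      | (r', Some y) => let: (T'', i) := tab_insert y T' in (r' :: T'', i.+1)
      end
  end.

(* Here i is a 0-based row index; if i = size T a new row is created. *)
Definition add_box (T : tableau) (i a : nat) : tableau :=
  set_nth [::] T i (rcons (nth [::] T i) a).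

Definition RSK_step (PQ : tableau * tableau) (xa : nat * nat) :
    tableau * tableau :=
  let: (P', i) := tab_insert xa.1 PQ.1 in (P', add_box PQ.2 i xa.2).

Definition RSK (w : seq nat) : tableau * tableau :=
  foldl RSK_step ([::], [::]) (zip w (iota 1 (size w))).

Definition nrows (T : tableau) : nat := size T.

Definition ncols (T : tableau) : nat := size (head [::] T).

(* In is_cell and entry, rows and columns are numbered from 1; entry T i j is
   meaningful only when is_cell T i j holds. *)
Definition is_cell (T : tableau) (i j : nat) : bool :=
  (1 <= i <= size T) && (1 <= j <= size (nth [::] T i.-1)).

Definition entry (T : tableau) (i j : nat) : nat :=
  nth 0 (nth [::] T i.-1) j.-1.

Definition has_increasing_chain (T : tableau) (c r : nat) : Prop :=
  exists j : nat -> nat,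
    [/\ j 1 = c,
        forall i, 1 <= i <= r -> is_cell T i (j i)
      & forall i, 1 <= i < r -> entry T i (j i) < entry T i.+1 (j i.+1)].

(* Main.v *)
Require Import Defs.
From mathcomp Require Import all_boot all_fingroup.
From mathcomp Require Import zify.
(** The word [sigma] is a set of points (value, time), and everything is read
off the geometry of this set, following Viennot.

A pile of the set consists of the points at which a longest ascending chain of
a given length ends. The piles are determined by two properties symmetric in
value and time ([piles_uniq]): no two points of a pile are comparable, and
below each point there is a point of the preceding pile. Row insertion into
the first row of P computes them: the first row of P lists the least values of
the piles, the first row of Q their least times, and the entries bumped to the
second row are the corners (value of p, time of q) for p, q consecutive in a
pile, which form the skeleton ([row_scan_shadow]). Hence the lower rows of
(P, Q) are the RSK tableaux of the skeleton ([RSK_points_cons]). As this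
picture is symmetric, exchanging values and times exchanges P and Q
([RSK_inverse]). Schensted's theorem follows too: the number of piles is the
length of a longest ascending chain, while descending chains of the set
interleave with those of its skeleton ([skeleton_between], [points_between]),
so that passing to the skeleton shortens the longest descending chain by
exactly one, as it removes one row ([schensted_inc], [schensted_dec]).

Extending [sigma] to the right by [t] inserts one more entry in P. By
Schensted's theorem the extension contains a forbidden pattern, when [sigma]
does not, iff the new cell lies in a new column k or a new row l. Taking t
extreme forces P to have k - 1 columns and l - 1 rows. If t exceeds the last
entry p of the first row, a new column appears. Otherwise a new row must
appear; the smaller t, the easier this is, so the case t = p decides. Each row
bumps its least entry exceeding the incoming one, hence a new row appears iff
an increasing sequence of entries, one in each row, starts at p: a greedy
choice succeeds whenever any choice does ([tab_insert_size]). This gives the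
condition on P ([right_crucialP]). An extension from above is, after exchanging
values and times, an extension of the inverse to the right
([points_ext_swap]), and the tableaux of the inverse are (Q, P), whence the
condition on Q. *)

Set Implicit Arguments.
Unset Strict Implicit.
Unset Printing Implicit Defensive.

Implicit Types (p q z b d : nat * nat) (A K : seq (nat * nat)).

(** Points drawn from a membership statement carry the type computed by the
equality structure; simplification exposes pairs of natural numbers. *)
Ltac point_lia := simpl in *; lia.

(** * Piles and shadow lines of a set of points *)
Definition ascends (p q : nat * nat) : bool := (p.1 < q.1) && (p.2 < q.2).
Definition descends (p q : nat * nat) : bool := (q.1 < p.1) && (p.2 < q.2).

Definition has_chain (r : rel (nat * nat)) (m : nat) (A : seq (nat * nat)) :=
  exists s, [/\ {subset s <= A}, size s = m & sorted r s].

Definition generic (A : seq (nat * nat)) : Prop :=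
  {in A &, injective fst} /\ {in A &, injective snd}.

(** These two properties hold of exactly one function [c] on [A]: the length of
a longest ascending chain of points strictly below the given one. Stated in this way
they are visibly invariant under the exchange of the two coordinates. *)
Definition piles (A : seq (nat * nat)) (c : nat * nat -> nat) : Prop :=
  {in A &, forall p q, c p = c q -> ~~ ascends p q} /\
  {in A, forall p j, c p = j.+1 -> exists2 z, z \in A & c z = j /\ ascends z p}.

Definition minima (f : nat * nat -> nat) (A : seq (nat * nat))
    (c : nat * nat -> nat) (R : seq nat) : Prop :=
  {in A, forall p, c p < size R} /\
  (forall j, j < size R -> exists2 p, p \in A &
     [/\ c p = j, f p = nth 0 R j & {in A, forall q, c q = j -> f p <= f q}]).

Definition covers (A : seq (nat * nat)) (c : nat * nat -> nat)
    (p q : nat * nat) : Prop :=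
  [/\ p \in A, q \in A, c p = c q, p.2 < q.2
    & {in A, forall r, c r = c p -> ~~ (p.2 < r.2 < q.2)}].

(** Joining the points of each pile by a staircase, the shadow line, makes the
skeleton the set of its corners between successive points. *)
Definition skeleton (A : seq (nat * nat)) (c : nat * nat -> nat)
    (K : seq (nat * nat)) : Prop :=
  forall b, b \in K <-> exists p q, covers A c p q /\ b = (p.1, q.2).

Definition shadow (A : seq (nat * nat)) (c : nat * nat -> nat)
    (R S : seq nat) (K : seq (nat * nat)) : Prop :=
  [/\ piles A c, minima fst A c R, minima snd A c S & skeleton A c K].

Lemma ascends_trans : transitive ascends.
Proof. by move=> q p r /andP[??] /andP[??]; apply/andP; split; lia. Qed.

Lemma descends_trans : transitive descends.
Proof. by move=> q p r /andP[??] /andP[??]; apply/andP; split; lia. Qed.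

(** If c q <= c p, descending from p pile by pile reaches a point of the pile of
q that is still below q, against the first property of piles. *)
Lemma piles_mono A c p q :
  piles A c -> p \in A -> q \in A -> ascends p q -> c p < c q.
Proof.
move=> [anti below] pA qA npq; rewrite ltnNge; apply/negP => le_qp.
have [z zA [cz]] : exists2 z, z \in A & c z = c q /\ (z = p \/ ascends z p).
  elim: {p npq le_qp}(c p - c q) {-2}p pA (erefl (c p - c q)) le_qp
    => [|d IHd] p pA def_d le_qp.
    by exists p => //; split; [lia|left].
  have [|z zA [cz nzp]] := below p pA (c p).-1; first by lia.
  have [||z' z'A [cz' nz']] := IHd z zA; try lia.
  exists z' => //; split=> //; right.
  by case: nz' => [->//|/ascends_trans]; apply.
move=> nzp; apply/negP: (anti z q zA qA cz); rewrite negbK.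
by case: nzp => [->//|/ascends_trans]; apply.
Qed.

(** Descending pile by pile, [c p] is the length of an ascending chain below p,
and along this chain [c'] increases. *)
Lemma piles_le A A' c c' :
  A =i A' -> piles A c -> piles A' c' -> {in A, forall p, c p <= c' p}.
Proof.
move=> eqA [_ below] pc' p; move: {2}(c p) (erefl (c p)) => j.
elim: j p => [|j IHj] p cp pA; first by rewrite cp.
have [z zA [cz nzp]] := below p pA j cp.
rewrite cp -cz (leq_ltn_trans (IHj z cz zA)) //.
by apply: (piles_mono pc') => //; rewrite -eqA.
Qed.

Lemma piles_uniq A A' c c' :
  A =i A' -> piles A c -> piles A' c' -> {in A, c =1 c'}.
Proof.
move=> eqA pc pc' p pA; apply/eqP; rewrite eqn_leq (piles_le eqA) //=.
by apply: (piles_le (fun x => esym (eqA x))) => //; rewrite -eqA.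
Qed.

Lemma minima_size f g A c R S : minima f A c R -> minima g A c S -> size R = size S.
Proof.
move=> [ltR minR] [ltS minS]; apply/eqP; rewrite eqn_leq.
by apply/andP; split; rewrite leqNgt; apply/negP;
  [move=> /minR[p pA [cp _ _]]|move=> /minS[p pA [cp _ _]]];
  [have := ltS p pA|have := ltR p pA]; rewrite cp ltnn.
Qed.

Lemma minima_uniq f A A' c c' R R' :
    A =i A' -> {in A, c =1 c'} -> minima f A c R -> minima f A' c' R' -> R = R'.
Proof.
move=> eqA eqc minR minR'.
have {}minR' : minima f A c R'.
  case: minR' => ltR' minR'; split=> [p pA|j /minR'[p]].
    by rewrite eqc // ltR' // -eqA.
  rewrite -eqA => pA [cp fp lep]; exists p => //; split=> // [|q qA].
    by rewrite eqc.
  by rewrite eqc //; apply: lep; rewrite -eqA.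
have eq_size := minima_size minR minR'.
apply: (@eq_from_nth _ 0) => // j ltj.
have [p pA [cp <- lep]] := minR.2 j ltj.
have [|q qA [cq <- leq]] := minR'.2 j; first by rewrite -eq_size.
by apply/eqP; rewrite eqn_leq lep // leq.
Qed.

Lemma covers_eq A A' c c' p q :
  A =i A' -> {in A, c =1 c'} -> covers A c p q -> covers A' c' p q.
Proof.
move=> eqA eqc [pA qA cpq ltpq nomid]; split; rewrite -?eqA -?eqc //.
by move=> r; rewrite -eqA => rA; rewrite -eqc //; apply: nomid.
Qed.

Lemma shadow_uniq A A' c c' R R' S S' K K' :
    A =i A' -> shadow A c R S K -> shadow A' c' R' S' K' ->
  [/\ R = R', S = S' & K =i K'].
Proof.
move=> eqA [pc mR mS sK] [pc' mR' mS' sK'].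
have eqc := piles_uniq eqA pc pc'.
have eqA' p : (p \in A') = (p \in A) by rewrite eqA.
have eqc' : {in A', c' =1 c} by move=> p pA; rewrite eqc // eqA.
split; [exact: minima_uniq mR mR'|exact: minima_uniq mS mS'|].
move=> b; apply/idP/idP => [/sK|/sK'] [p [q [cpq ->]]].
  by apply/sK'; exists p, q; split=> //; apply: covers_eq cpq.
by apply/sK; exists p, q; split=> //; apply: covers_eq cpq.
Qed.

Definition swap (p : nat * nat) : nat * nat := (p.2, p.1).

Arguments swap p : simpl never.

Lemma swapK : involutive swap. Proof. by case. Qed.

Lemma mem_swap A p : (p \in map swap A) = (swap p \in A).
Proof. by rewrite -{1}[p]swapK (mem_map (inv_inj swapK)). Qed.

(** A pile is a descending staircase: time order is reverse value order. This is
what makes the least value the latest point, and consecutive in time the same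
as consecutive in value. *)
Lemma pile_order A c p q :
    generic A -> piles A c -> p \in A -> q \in A -> c p = c q ->
  (p.2 < q.2) = (q.1 < p.1).
Proof.
move=> [inj1 inj2] [anti _] pA qA cpq.
have [eq1|ne1] := eqVneq p.1 q.1; first by rewrite (inj1 p q) // !ltnn.
have [eq2|ne2] := eqVneq p.2 q.2; first by rewrite (inj2 p q) // !ltnn.
have := anti p q pA qA cpq; have := anti q p qA pA (esym cpq).
rewrite /ascends; case: (ltngtP p.1 q.1) ne1; case: (ltngtP p.2 q.2) ne2 => //=.
Qed.

(** The exchange reverses the direction in which a staircase is travelled. *)
Lemma covers_swap A c p q :
    generic A -> piles A c -> covers A c p q ->
  covers (map swap A) (c \o swap) (swap q) (swap p).
Proof.
move=> gA pc [pA qA cpq ltpq nomid].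
split; rewrite ?mem_swap ?swapK //= ?swapK //.
  by rewrite -(pile_order gA pc).
move=> r; rewrite mem_swap => rA cr.
have {}cr : c (swap r) = c q by [].
have := nomid _ rA (etrans cr (esym cpq)).
rewrite andbC (pile_order gA pc rA qA cr).
by rewrite (pile_order gA pc pA rA (etrans cpq (esym cr))).
Qed.

Lemma generic_swap A : generic A -> generic (map swap A).
Proof.
move=> [inj1 inj2]; split=> p q; rewrite !mem_swap => pA qA e.
  by apply: (inv_inj swapK); apply: inj2.
by apply: (inv_inj swapK); apply: inj1.
Qed.

Lemma ascends_swap p q : ascends (swap p) (swap q) = ascends p q.
Proof. by rewrite /ascends andbC. Qed.

Lemma piles_swap A c : piles A c -> piles (map swap A) (c \o swap).
Proof.
move=> [anti below]; split=> [p q|p].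
  by rewrite !mem_swap => pA qA /(anti _ _ pA qA); rewrite ascends_swap.
rewrite mem_swap => pA j /(below _ pA)[z zA [cz nz]].
exists (swap z); rewrite ?mem_swap /= swapK //; split=> //.
by rewrite -ascends_swap swapK.
Qed.

Lemma minima_swap f A c R :
  minima f A c R -> minima (f \o swap) (map swap A) (c \o swap) R.
Proof.
move=> [ltR minR]; split=> [p|j /minR[p pA [cp fp lep]]].
  by rewrite mem_swap => /ltR.
exists (swap p); rewrite ?mem_swap /= ?swapK //; split=> // q.
by rewrite mem_swap; apply: lep.
Qed.

Lemma shadow_swap A c R S K :
    generic A -> shadow A c R S K ->
  shadow (map swap A) (c \o swap) S R (map swap K).
Proof.
move=> gA [pc mR mS sK]; split; first exact: piles_swap.
- exact: (minima_swap mS).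
- exact: (minima_swap mR).
move=> b; rewrite mem_swap; split=> [/sK[p [q [cov eb]]]|[p [q [cov ->]]]].
  exists (swap q), (swap p); split; first exact: covers_swap.
  by rewrite -[b]swapK eb.
apply/sK; exists (swap q), (swap p); split=> //.
have := covers_swap (generic_swap gA) (piles_swap pc) cov.
apply: covers_eq => [r|r _]; first by rewrite !mem_swap swapK.
by rewrite /= swapK.
Qed.

Lemma row_insertE x r :
  row_insert x r = (set_nth 0 r (find (ltn x) r) x,
                    if find (ltn x) r < size r
                    then Some (nth 0 r (find (ltn x) r)) else None).
Proof. by elim: r => //= y r ->; case: ifP => //= _; rewrite ltnS; case: ifP. Qed.

(** * Row insertion computes the shadow lines *)

(** The effect of an RSK step on the first rows alone, with the bumped entries
kept as a set of points whose times are those of the bumps. *)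
Definition scan_step (st : seq nat * seq nat * seq (nat * nat)) (xa : nat * nat) :
    seq nat * seq nat * seq (nat * nat) :=
  let: (R, T, K) := st in
  match row_insert xa.1 R with
  | (R', None) => (R', rcons T xa.2, K)
  | (R', Some y) => (R', T, rcons K (y, xa.2))
  end.

Definition row_scan (A : seq (nat * nat)) := foldl scan_step ([::], [::], [::]) A.

Definition RSK_points (A : seq (nat * nat)) : tableau * tableau :=
  foldl RSK_step ([::], [::]) A.

(** The lower rows see only the entries bumped out of the first row, at the times
at which they were bumped. *)
Lemma RSK_points_cons A R S K :
    row_scan A = (R, S, K) -> A != [::] ->
  RSK_points A = (R :: (RSK_points K).1, S :: (RSK_points K).2).
Proof.
elim/last_ind: A R S K => // A [x a] IHA R S K.
have [->|A_neq0] := eqVneq A [::]; first by case=> <- <- <-.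
rewrite /row_scan /RSK_points !foldl_rcons -/(row_scan A) -/(RSK_points A).
case def_st: (row_scan A) => [[R0 S0] K0] /=.
rewrite (IHA _ _ _ def_st A_neq0) /RSK_step /=.
case: (row_insert x R0) => R' [y|] [<- <- <-] _ //=.
rewrite /RSK_points foldl_rcons /= -/(RSK_points K0) /RSK_step /=.
by case: (RSK_points K0) => P1 Q1 /=; case: (tab_insert y P1).
Qed.

Definition by_time (A : seq (nat * nat)) : Prop :=
  sorted ltn (unzip2 A) /\ uniq (unzip1 A).

Lemma uniq_map_inj (f : nat * nat -> nat) A : uniq (map f A) -> {in A &, injective f}.
Proof.
elim: A => // p A IHA /=/andP[/mapP notA uA] q r; rewrite !inE.
case/predU1P=> [->|qA] /predU1P[->|rA] // e; last exact: (IHA uA).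
  by case: notA; exists r.
by case: notA; exists q.
Qed.

Lemma by_time_generic A : by_time A -> generic A.
Proof.
move=> [sA uA]; split; apply: uniq_map_inj => //.
exact: (sorted_uniq ltn_trans ltnn sA).
Qed.

Lemma sorted_rcons_ltn s a :
  sorted ltn (rcons s a) = sorted ltn s && all (ltn^~ a) s.
Proof.
rewrite -cats1 (sorted_pairwise ltn_trans) pairwise_cat /= andbT.
by rewrite (sorted_pairwise ltn_trans) allrel1r andbC.
Qed.

Lemma by_time_rcons A x a :
  by_time (rcons A (x, a)) ->
  [/\ by_time A, {in A, forall p, p.1 != x} & {in A, forall p, p.2 < a}].
Proof.
rewrite /by_time /unzip1 /unzip2 !map_rcons rcons_uniq sorted_rcons_ltn /=.
move=> [/andP[sA /allP ltA] /andP[/mapP xA uA]]; split=> // p pA.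
  by apply/eqP=> px; case: xA; exists p.
by apply: (ltA p.2); apply: map_f.
Qed.

(** The new point (x, a) joins the pile of the first entry exceeding x, or starts
a pile if there is none. That entry is the least value of its pile, held by its
latest point, so the new point extends the staircase downwards and the corner
created is exactly the bumped entry; the previous entry does not exceed x, so a
point of the preceding pile lies below. *)
Lemma row_scan_shadow A R S K :
    by_time A -> row_scan A = (R, S, K) ->
  exists c, shadow A c R S K.
Proof.
elim/last_ind: A R S K => [|A [x a] IHA] R' S' K'.
  move=> _ [<- <- <-]; exists (fun => 0); split; do 1?split=> // b.
  by split=> // [[p [q [[]]]]].
move=> btA'; have [btA xA ltA] := by_time_rcons btA'.
rewrite /row_scan foldl_rcons -/(row_scan A).
case def_st: (row_scan A) => [[R S] K].
have {IHA def_st}[c [[anti below] [ltR minR] [ltS minS] sK]] := IHA _ _ _ btA def_st.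
have eqRS : size R = size S := minima_size (conj ltR minR) (conj ltS minS).
have gA := by_time_generic btA.
rewrite /= row_insertE; set j := find (ltn x) R.
pose c' p := if p.2 == a then j else c p.
have c'A p : p \in A -> c' p = c p.
  by move=> /ltA ltpa; rewrite /c' ltn_eqF.
have c'x : c' (x, a) = j by rewrite /c' eqxx.
have ltaA p : p \in A -> (a < p.2) = false.
  by move=> /ltA ltpa; rewrite ltnNge (ltnW ltpa).
have le_j : j <= size R := find_size _ _.
have lt_xR p : p \in A -> c p = j -> x < p.1.
  move=> pA cp; have ltj := ltR p pA; rewrite cp in ltj.
  have [q qA [cq q1 leq]] := minR j ltj.
  have := @nth_find _ 0 (ltn x) R; rewrite has_find => /(_ ltj) /= ltx.
  by apply: (leq_trans ltx); rewrite -q1; apply: leq.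
have piles' : piles (rcons A (x, a)) c'.
  split=> [p q|p].
    rewrite !mem_rcons !inE => /predU1P[->|pA] /predU1P[->|qA].
    - by rewrite /ascends ltnn.
    - by rewrite /ascends /= ltaA ?andbF.
    - rewrite c'x c'A // => cp; rewrite /ascends negb_and /= -leqNgt ltnW //.
      exact: lt_xR.
    by rewrite !c'A //; apply: anti.
  rewrite mem_rcons inE => /predU1P[->|pA] i.
    rewrite c'x => ji; have lti : i < j by rewrite ji.
    have [z zA [cz z1 _]] := minR i (leq_trans lti le_j).
    exists z; first by rewrite mem_rcons inE zA orbT.
    rewrite c'A // /ascends /= ltA // andbT ltn_neqAle xA // z1 leqNgt.
    by split=> //; apply/negP; have /= -> := before_find 0 lti.
  rewrite c'A // => /(below p pA)[z zA [cz nz]].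
  by exists z; rewrite ?mem_rcons ?inE ?zA ?orbT // c'A.
have minR' : minima fst (rcons A (x, a)) c' (set_nth 0 R j x).
  split=> [p|i]; rewrite size_set_nth.
    rewrite mem_rcons inE => /predU1P[->|pA]; first by rewrite c'x leq_maxl.
    by rewrite c'A // leq_max ltR ?orbT.
  have [->|ne_ij] := eqVneq i j => lti.
    exists (x, a); first by rewrite mem_rcons mem_head.
    rewrite c'x nth_set_nth /= eqxx; split=> // q.
    rewrite mem_rcons inE => /predU1P[->//|qA]; rewrite c'A // => cq.
    by rewrite ltnW // lt_xR.
  have ltiR : i < size R by move/eqP: ne_ij; move: lti le_j; lia.
  have [p pA [cp p1 lep]] := minR i ltiR.
  exists p; first by rewrite mem_rcons inE pA orbT.
  rewrite c'A // nth_set_nth /= (negPf ne_ij); split=> // q.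
  rewrite mem_rcons inE => /predU1P[->|qA].
    by rewrite c'x => ji; rewrite ji eqxx in ne_ij.
  by rewrite c'A //; apply: lep.
have minS' : minima snd (rcons A (x, a)) c' (if j < size R then S else rcons S a).
  have le_jS : j < size (if j < size R then S else rcons S a).
    by case: ifP => ltj; rewrite ?size_rcons ?ltnS -?eqRS.
  split=> [p|i lti].
    rewrite mem_rcons inE => /predU1P[->|pA]; first by rewrite c'x.
    by rewrite c'A //; case: ifP => _; rewrite ?size_rcons ?leqW ?ltS.
  have [ltiS|leiS] := ltnP i (size S).
    have [p pA [cp p2 lep]] := minS i ltiS.
    exists p; first by rewrite mem_rcons inE pA orbT.
    rewrite c'A //; split=> // [|q].
      by case: ifP => _ //; rewrite nth_rcons ltiS.
    rewrite mem_rcons inE => /predU1P[->|qA]; first by rewrite ltnW ?ltA.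
    by rewrite c'A //; apply: lep.
  case: ifP lti le_jS => [_ lti|ltj lti le_jS]; first by rewrite ltnNge leiS in lti.
  have eqi : i = size S by move: lti; rewrite size_rcons; lia.
  have eqj : j = size S by move: ltj le_j; rewrite eqRS; lia.
  exists (x, a); first by rewrite mem_rcons mem_head.
  rewrite c'x eqi eqj nth_rcons ltnn eqxx; split=> // q.
  rewrite mem_rcons inE => /predU1P[->//|qA]; rewrite c'A // => cq.
  by have := ltS q qA; rewrite cq ltnn.
have sK' : skeleton (rcons A (x, a)) c'
    (if j < size R then rcons K (nth 0 R j, a) else K).
  have cov_old p q : q \in A -> covers (rcons A (x, a)) c' p q <-> covers A c p q.
    move=> qA; split=> [[]|[pA _ cpq ltpq nomid]].
      rewrite mem_rcons inE => /predU1P[->|pA] _ + ltpq.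
        by move: ltpq; rewrite /= ltaA.
      rewrite !c'A // => cpq nomid; split=> // r rA cr.
      by apply: nomid; rewrite ?c'A // mem_rcons inE rA orbT.
    split; rewrite ?c'A ?mem_rcons ?inE ?pA ?qA ?orbT //.
    move=> r; rewrite mem_rcons inE => /predU1P[->|rA] cr /=.
      by rewrite ltaA ?andbF.
    by apply: nomid; rewrite ?c'A // in cr *.
  have cov_new p : covers (rcons A (x, a)) c' p (x, a) <->
      [/\ p \in A, j < size R & p.1 = nth 0 R j].
    split=> [[]|[pA ltj p1]].
      rewrite mem_rcons inE => /predU1P[->|pA] _; first by rewrite ltnn.
      rewrite c'A // c'x => cp _ nomid.
      have ltj : j < size R by rewrite -cp ltR.
      split=> //; have [q qA [cq <- leq]] := minR j ltj.
      apply/eqP; rewrite eqn_leq leq // andbT leqNgt.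
      rewrite -(pile_order gA (conj anti below)) ?cp ?cq //.
      have := nomid q; rewrite mem_rcons inE qA orbT => /(_ isT).
      by rewrite !c'A // cp cq => /(_ erefl); rewrite /= ltA // andbT.
    have [q qA [cq q1 leq]] := minR j ltj.
    have ? : p = q by apply: gA.1; rewrite ?q1.
    subst q; split; rewrite ?mem_rcons ?mem_head ?inE ?pA ?orbT //.
    - by rewrite c'A // c'x.
    - exact: ltA.
    move=> r; rewrite mem_rcons inE => /predU1P[->|rA]; first by rewrite ltnn andbF.
    rewrite !c'A // => cr; rewrite negb_and -leqNgt leqNgt.
    rewrite (pile_order gA (conj anti below)) // -leqNgt leq // cr cq //.
  move=> b; split=> [bK|[p [q [+ ->]]]].
    have [bKo|[ltj ->]] : b \in K \/ j < size R /\ b = (nth 0 R j, a).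
    - move: bK; case: ifP => [ltj|]; last by left.
      by rewrite mem_rcons inE => /predU1P[->|]; [right|left].
    - have [p [q [cov ->]]] := (sK b).1 bKo.
      exists p, q; split=> //; apply/cov_old => //; by case: cov.
    have [p pA [cp p1 _]] := minR j ltj.
    by exists p, (x, a); split; [apply/cov_new|rewrite p1].
  have [->|neq] := eqVneq q (x, a).
    by case/cov_new=> _ -> ->; rewrite mem_rcons mem_head.
  move=> cov; have qA : q \in A.
    by case: cov => _; rewrite mem_rcons inE (negPf neq).
  have: (p.1, q.2) \in K by apply/sK; exists p, q; split=> //; apply/cov_old.
  by case: ifP => // _; rewrite mem_rcons inE => ->; rewrite orbT.
by move: minS' sK'; case: ifP => _ minS' sK' [<- <- <-]; exists c'; split.
Qed.

Lemma row_scan_times A R S K :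
    by_time A -> row_scan A = (R, S, K) ->
  sorted ltn (unzip2 K) /\ {subset unzip2 K <= unzip2 A}.
Proof.
elim/last_ind: A R S K => [|A [x a] IHA] R' S' K'; first by move=> _ [_ _ <-].
move=> btA'; have [btA _ ltA] := by_time_rcons btA'.
rewrite /row_scan foldl_rcons -/(row_scan A).
case def_st: (row_scan A) => [[R S] K].
have [sK subK] := IHA _ _ _ btA def_st.
have subA : {subset unzip2 A <= unzip2 (rcons A (x, a))}.
  by move=> t tA; rewrite /unzip2 map_rcons mem_rcons inE tA orbT.
rewrite /=; case: (row_insert x R) => R1 [y|] [_ _ <-]; last first.
  by split=> // t /subK/subA.
split.
  rewrite /unzip2 map_rcons sorted_rcons_ltn sK; apply/allP=> t /subK /mapP[p pA ->].
  exact: ltA.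
move=> t; rewrite {1}/unzip2 map_rcons mem_rcons inE => /predU1P[->|/subK/subA//].
by rewrite /unzip2 map_rcons mem_rcons mem_head.
Qed.

Lemma row_scan_size A R S K : row_scan A = (R, S, K) -> size R + size K = size A.
Proof.
elim/last_ind: A R S K => [|A [x a] IHA] R' S' K'; first by case=> <- _ <-.
rewrite /row_scan foldl_rcons -/(row_scan A) size_rcons.
case def_st: (row_scan A) => [[R S] K]; rewrite -(IHA _ _ _ def_st) /= row_insertE.
have := find_size (ltn x) R.
case: ifP => ltj lej [<- _ <-]; rewrite ?size_rcons size_set_nth; lia.
Qed.

(** Two corners with the same value have the same first point, hence the same
second one; so the construction can be iterated. *)
Lemma row_scan_by_time A R S K :
  by_time A -> row_scan A = (R, S, K) -> by_time K.
Proof.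
move=> btA def_st; have [sK _] := row_scan_times btA def_st.
have [c [pc _ _ skK]] := row_scan_shadow btA def_st.
have gA := by_time_generic btA.
split=> //; rewrite map_inj_in_uniq.
  by apply: (@map_uniq _ _ snd); apply: (sorted_uniq ltn_trans ltnn sK).
move=> b b' /skK[p [q [[pA qA cpq ltpq midq] ->]]].
move=> /skK[p' [q' [[p'A q'A cpq' ltpq' midq'] ->]]] /= eqp.
have ? := gA.1 _ _ pA p'A eqp; subst p'; congr pair.
have := midq q' q'A (esym cpq'); have := midq' q qA (esym cpq).
by rewrite ltpq ltpq' /=; case: ltngtP.
Qed.

(** Induction through the skeletons: the first rows of P and Q are exchanged, and
the skeleton of the exchanged set is the exchanged skeleton. *)
Lemma RSK_points_swap A A' :
    by_time A -> by_time A' -> A' =i map swap A ->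
  RSK_points A' = ((RSK_points A).2, (RSK_points A).1).
Proof.
move: {2}(size A).+1 (ltnSn (size A)) => m.
elim: m A A' => // m IHm A A' ltAm btA btA' eqA.
have [A0|A_neq0] := eqVneq A [::].
  by case: A' eqA {btA'} => [|p A' /(_ p)]; rewrite A0 // inE eqxx.
have A'_neq0 : A' != [::].
  by case: A A_neq0 eqA {ltAm btA} => // p A _ /(_ (swap p)); case: A' {btA'} => //;
    rewrite inE eqxx.
case def_st: (row_scan A) => [[R S] K]; case def_st': (row_scan A') => [[R' S'] K'].
have [c sh] := row_scan_shadow btA def_st.
have [c' sh'] := row_scan_shadow btA' def_st'.
have [eqR eqS eqK] := shadow_uniq eqA sh' (shadow_swap (by_time_generic btA) sh).
rewrite (RSK_points_cons def_st) // (RSK_points_cons def_st') //= eqR eqS.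
rewrite (IHm K K') //; [|exact: row_scan_by_time def_st|exact: row_scan_by_time def_st'].
have ltR : 0 < size R.
  case: sh => _ [ltR _] _ _; case: A A_neq0 ltR {ltAm btA eqA def_st} => // p A _.
  by move/(_ p (mem_head _ _)); apply: leq_ltn_trans.
have := row_scan_size def_st; lia.
Qed.

(** * Chains and the shape of the tableaux *)

(** The pile index increases along an ascending chain; conversely one descends
from a point of the last pile. *)
Lemma shadow_ascending_chain A c R S K m :
  shadow A c R S K -> has_chain ascends m A <-> m <= size R.
Proof.
move=> [pc [ltR minR] _ _]; split=> [[s [sA <- ss]]|].
  case: s sA ss => // p s sA ss.
  suff: c p + size s < size R by move=> /=; lia.
  elim: s p sA ss => [|q s IHs] p sA; first by rewrite addn0 ltR ?sA ?mem_head.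
  move=> /= /andP[npq sqs]; have pA : p \in A by rewrite sA ?mem_head.
  have sA' : {subset q :: s <= A} by move=> r rs; rewrite sA // inE rs orbT.
  have qA : q \in A by rewrite sA' ?mem_head.
  rewrite addnS -addSn (leq_ltn_trans _ (IHs q sA' sqs)) // leq_add2r.
  exact: (piles_mono pc pA qA npq).
case: m => [|m] ltm; first by exists [::].
have [p pA [cp _ _]] := minR m ltm.
have [s [sA sz ss lts]] : exists s,
    [/\ {subset s <= A}, size s = m, sorted ascends s & all (ascends^~ p) s].
  elim: m p pA cp {ltm} => [|m IHm] p pA cp; first by exists [::].
  have [z zA [cz nz]] := pc.2 p pA m cp.
  have [s [sA sz ss lts]] := IHm z zA cz.
  exists (rcons s z); split.
  - by move=> q; rewrite mem_rcons inE => /predU1P[->|/sA].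
  - by rewrite size_rcons sz.
  - rewrite -cats1 (sorted_pairwise ascends_trans) pairwise_cat /= andbT allrel1r.
    by rewrite -(sorted_pairwise ascends_trans) lts.
  - rewrite all_rcons nz; apply: sub_all lts => q nq; exact: ascends_trans nq nz.
exists (rcons s p); split.
- by move=> q; rewrite mem_rcons inE => /predU1P[->|/sA].
- by rewrite size_rcons sz.
- rewrite -cats1 (sorted_pairwise ascends_trans) pairwise_cat /= andbT allrel1r.
  by rewrite -(sorted_pairwise ascends_trans) lts.
Qed.

Lemma cover_succ A c p z :
    p \in A -> z \in A -> c p = c z -> p.2 < z.2 ->
  exists2 q, covers A c p q & q.2 <= z.2.
Proof.
move: {2}z.2.+1 (ltnSn z.2) => m.
elim: m z => // m IHm z ltzm pA zA cpz ltpz.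
case: (altP (@hasP _ (fun r => (c r == c p) && (p.2 < r.2 < z.2)) A)).
  move=> [r rA /andP[/eqP cr /andP[ltpr ltrz]]].
  have [|q cov leq] := IHm r _ pA rA (esym cr) ltpr; first exact: leq_trans ltrz ltzm.
  by exists q => //; apply: leq_trans leq (ltnW ltrz).
move=> /hasPn nomid; exists z => //; split=> // r rA cr.
by have := nomid r rA; rewrite cr eqxx.
Qed.

Lemma cover_pred A c q z :
    q \in A -> z \in A -> c z = c q -> z.2 < q.2 ->
  exists2 p, covers A c p q & z.2 <= p.2.
Proof.
move: {2}(q.2 - z.2).+1 (ltnSn (q.2 - z.2)) => m.
elim: m z => // m IHm z ltzm qA zA czq ltzq.
case: (altP (@hasP _ (fun r => (c r == c q) && (z.2 < r.2 < q.2)) A)).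
  move=> [r rA /andP[/eqP cr /andP[ltzr ltrq]]].
  have [|p cov lep] := IHm r _ qA rA cr ltrq.
    by rewrite ltnS in ltzm; apply: leq_trans ltzm; rewrite ltn_sub2l.
  by exists p => //; apply: leq_trans (ltnW ltzr) lep.
move=> /hasPn nomid; exists z => //; split=> // r rA cr.
by have := nomid r rA; rewrite cr czq eqxx.
Qed.

Lemma pile_le_order A c p q :
    generic A -> piles A c -> p \in A -> q \in A -> c p = c q ->
  (p.2 <= q.2) = (q.1 <= p.1).
Proof. by move=> gA pc pA qA cpq; rewrite leqNgt (pile_order gA pc) // -leqNgt. Qed.

Lemma pile_lower A c p j :
  piles A c -> p \in A -> j < c p -> exists2 z, z \in A & c z = j /\ ascends z p.
Proof.
move=> pc pA; move: {2}(c p - j) (erefl (c p - j)) => m.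
elim: m p pA => [|m IHm] p pA e ltj; first lia.
have [|z zA [cz nzp]] := pc.2 p pA (c p).-1; first lia.
have [eqj|ne_j] := eqVneq (c z) j; first by exists z.
have [||y yA [cy nyz]] := IHm z zA; [lia..|].
by exists y => //; split=> //; apply: ascends_trans nzp.
Qed.

(** If x lies in an earlier pile than y, the pile of x has a point below y; it
comes after x, so the corner following x on its staircase lies in the box. If
x lies in a later pile, the corner preceding y does, for the same reason;
in a common pile both do. *)
Lemma skeleton_between A c K (x y : nat * nat) :
    generic A -> piles A c -> skeleton A c K -> x \in A -> y \in A -> descends x y ->
  exists2 b, b \in K & (y.1 < b.1 <= x.1) && (x.2 < b.2 <= y.2).
Proof.
move=> gA pc sK xA yA /andP[gt1 lt2].
have [ltc|ltc|eqc] := ltngtP (c x) (c y).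
- have [z zA [cz /andP[z1 z2]]] := pile_lower pc yA ltc.
  have ltxz : x.2 < z.2 by rewrite (pile_order gA pc) //; point_lia.
  have [q cov leq] := cover_succ xA zA (esym cz) ltxz.
  exists (x.1, q.2); first by apply/sK; exists x, q.
  by case: cov => *; rewrite /=; point_lia.
- have [z zA [cz /andP[z1 z2]]] := pile_lower pc xA ltc.
  have ltzy : z.2 < y.2 by point_lia.
  have [p cov lep] := cover_pred yA zA cz ltzy.
  exists (p.1, y.2); first by apply/sK; exists p, y.
  case: cov => pA _ cpy ltpy _.
  have lt1 : y.1 < p.1 by rewrite -(pile_order gA pc).
  have le1 : p.1 <= z.1 by rewrite -(pile_le_order gA pc) // cz.
  point_lia.
have [q cov leq] := cover_succ xA yA eqc lt2.
exists (x.1, q.2); first by apply/sK; exists x, q.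
by case: cov => *; rewrite /=; point_lia.
Qed.

(** Dually, let b be the corner of p, q and d the corner of p', q'. If the pile
of b does not come after that of d, then p' is no earlier than q and is the
required point; if it does, then q lies above p' and is. *)
Lemma points_between A c K b d :
    generic A -> piles A c -> skeleton A c K -> b \in K -> d \in K -> descends b d ->
  exists2 x, x \in A & (d.1 <= x.1 < b.1) && (b.2 <= x.2 < d.2).
Proof.
move=> gA pc sK /sK[p [q [[pA qA cpq ltpq nomid] ->]]].
move=> /sK[p' [q' [[p'A q'A cpq' ltpq' nomid'] ->]]] /andP[/= gt1 lt2].
have lepq1 : q.1 < p.1 by rewrite -(pile_order gA pc).
have lepq1' : q'.1 < p'.1 by rewrite -(pile_order gA pc).
have [ltc|ltc|eqc] := ltngtP (c p) (c p').
- have [z zA [cz /andP[z1 z2]]] := pile_lower pc p'A ltc.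
  have ltpz : p.2 < z.2 by rewrite (pile_order gA pc) //; point_lia.
  have := nomid z zA cz; rewrite ltpz /= -leqNgt => leqz.
  by exists p' => //; point_lia.
- rewrite cpq cpq' in ltc.
  have [z zA [cz /andP[z1 z2]]] := pile_lower pc qA ltc.
  have := nomid' z zA (etrans cz (esym cpq')).
  have -> : z.2 < q'.2 by point_lia.
  rewrite andbT -leqNgt (pile_le_order gA pc) ?cz // => le1.
  by exists q => //; point_lia.
have := nomid p' p'A (esym eqc).
have : p.2 < p'.2 by rewrite (pile_order gA pc).
move=> -> /=; rewrite -leqNgt => leqp.
by exists p' => //; point_lia.
Qed.

(** The boxes given by the two interleaving lemmas for consecutive pairs of a
chain are themselves arranged in descending order. From the points to the
skeleton this loses one element. In the other direction it also loses one, but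
the first point of the first corner and the second point of the last corner can
be added at the ends. *)
Lemma shadow_descending_chain A c R S K m :
    generic A -> shadow A c R S K -> A != [::] ->
  has_chain descends m.+1 A <-> has_chain descends m K.
Proof.
move=> gA [pc _ _ sK] A_neq0; split=> [[[|x s] [sA //= [<-] ss]]|].
  (* the box condition on all of B is what lets the induction prepend a corner *)
  suff [B [BK sz sB _]] : exists B, [/\ {subset B <= K}, size B = size s, sorted descends B
      & all (fun b => (b.1 <= x.1) && (x.2 < b.2)) B] by exists B.
  elim: s x sA ss => [|y s IHs] x sA; first by exists [::].
  move=> /= /andP[sxy sys].
  have sA' : {subset y :: s <= A} by move=> r rs; rewrite sA // inE rs orbT.
  have [B [BK sz sB ltB]] := IHs y sA' sys.
  have xA : x \in A by rewrite sA ?mem_head.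
  have yA : y \in A by rewrite sA' ?mem_head.
  have [b bK /andP[b1 b2]] := skeleton_between gA pc sK xA yA sxy.
  exists (b :: B); split=> [d|||]; rewrite /= ?sz //.
  - by rewrite inE => /predU1P[->|/BK].
  - rewrite /= (path_sortedE descends_trans) sB andbT.
    by apply: sub_all ltB => d; rewrite /descends; point_lia.
  - apply/andP; split; first point_lia.
    by case/andP: sxy => ??; apply: sub_all ltB => d; point_lia.
move=> [[|b B] [BK <- sB]].
  case: A A_neq0 {gA pc sK} => // p A _.
  by exists [:: p]; split=> // q; rewrite !inE => ->.
have [X [XA sz sX ltX]] : exists X, [/\ {subset X <= A}, size X = size (b :: B),
    sorted descends X & all (fun x => (x.1 < b.1) && (b.2 <= x.2)) X].
  elim: B b BK sB => [|d B IHB] b BK.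
    have /sK[p [q [[pA qA cpq ltpq _] eb]]] := BK b (mem_head _ _).
    exists [:: q]; rewrite eb; split=> // [z|].
      by rewrite inE => /eqP->.
    by rewrite /= leqnn -(pile_order gA pc) // ltpq.
  move=> /= /andP[sbd sB].
  have BK' : {subset d :: B <= K} by move=> r rs; rewrite BK // inE rs orbT.
  have [X [XA sz sX ltX]] := IHB d BK' sB.
  have bK : b \in K by rewrite BK ?mem_head.
  have dK : d \in K by rewrite BK' ?mem_head.
  have [x xA /andP[x1 x2]] := points_between gA pc sK bK dK sbd.
  exists (x :: X); split=> [y|||]; rewrite /= ?sz //.
  - by rewrite inE => /predU1P[->|/XA].
  - rewrite /= (path_sortedE descends_trans) sX andbT.
    by apply: sub_all ltX => y; rewrite /descends; point_lia.
  - apply/andP; split; first point_lia.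
    by case/andP: sbd => ??; apply: sub_all ltX => y; point_lia.
have /sK[p [q [[pA qA cpq ltpq _] eb]]] := BK b (mem_head _ _).
(* p, to the left of the corner b, precedes all of X *)
exists (p :: X); split=> [y||]; rewrite /= ?sz //.
- by rewrite inE => /predU1P[->|/XA].
- rewrite (path_sortedE descends_trans) sX andbT.
  by apply: sub_all ltX => y; rewrite eb /descends /=; point_lia.
Qed.

Lemma ascending_chain_ncols A m :
  by_time A -> has_chain ascends m A <-> m <= ncols (RSK_points A).1.
Proof.
move=> btA; have [->|A_neq0] := eqVneq A [::].
  split=> [[s [sA <- _]]|]; last by case: m => // _; exists [::].
  by case: s sA => // p s /(_ p (mem_head _ _)).
case def_st: (row_scan A) => [[R S] K].
have [c sh] := row_scan_shadow btA def_st.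
by rewrite (RSK_points_cons def_st) //; apply: (shadow_ascending_chain m sh).
Qed.

Lemma descending_chain_nrows A m :
  by_time A -> has_chain descends m A <-> m <= nrows (RSK_points A).1.
Proof.
elim: m A => [|m IHm] A btA; first by split=> // _; exists [::].
have [->|A_neq0] := eqVneq A [::].
  split=> [[s [sA <- _]]|//].
  by case: s sA => // p s /(_ p (mem_head _ _)).
case def_st: (row_scan A) => [[R S] K].
have [c sh] := row_scan_shadow btA def_st.
have IH := IHm K (row_scan_by_time btA def_st).
rewrite (RSK_points_cons def_st) // /nrows /= ltnS.
by split=> [/(shadow_descending_chain m (by_time_generic btA) sh A_neq0)/IH|
  /IH/(shadow_descending_chain m (by_time_generic btA) sh A_neq0)].
Qed.

(** * Bumping down to a new row *)
Lemma row_insert_map f x r :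
    {mono f : a b / a < b} ->
  row_insert (f x) (map f r) =
    (map f (row_insert x r).1, omap f (row_insert x r).2).
Proof.
move=> f_mono; elim: r => //= y r IHr; rewrite f_mono; case: ifP => // _.
by rewrite IHr; case: (row_insert x r).
Qed.

Lemma tab_insert_map f x (T : tableau) :
    {mono f : a b / a < b} ->
  tab_insert (f x) (map (map f) T) =
    (map (map f) (tab_insert x T).1, (tab_insert x T).2).
Proof.
move=> f_mono; elim: T x => //= r T IHT x; rewrite (row_insert_map _ _ f_mono).
case: (row_insert x r) => r' [y|] //=; rewrite IHT.
by case: (tab_insert y T).
Qed.

Lemma RSK_points_map f A :
    {mono f : a b / a < b} ->
  RSK_points [seq (f p.1, p.2) | p <- A] =
    (map (map f) (RSK_points A).1, (RSK_points A).2).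
Proof.
move=> f_mono; elim/last_ind: A => // A [x a] IHA.
rewrite map_rcons /RSK_points !foldl_rcons -!/(RSK_points _) IHA.
case: (RSK_points A) => P Q; rewrite /RSK_step /= tab_insert_map //.
by case: (tab_insert x P).
Qed.

Lemma row_insert_sorted x r (z : nat) :
  z <= x -> path leq z r -> path leq z (row_insert x r).1.
Proof.
elim: r z => /= [|y r IHr] z lezx; first by rewrite lezx.
move=> /andP[lezy yr]; case: ifP => [ltxy|/negbT]; rewrite /=.
  rewrite lezx; move: yr; rewrite !(path_sortedE leq_trans) => /andP[ltyr ->].
  by rewrite andbT; apply: sub_all ltyr => a; apply: leq_trans (ltnW ltxy).
rewrite -leqNgt => leyx; have := IHr y leyx yr.
by case: (row_insert x r) => r' b /= ->; rewrite lezy.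
Qed.

Lemma tab_insert_sorted x (T : tableau) :
  all (path leq 0) T -> all (path leq 0) (tab_insert x T).1.
Proof.
elim: T x => //= r T IHT x /andP[sr sT].
have := row_insert_sorted (leq0n x) sr.
case: (row_insert x r) => r' [y|] /= sr'; last by rewrite /= sr'.
by have := IHT y sT; case: (tab_insert y T) => T' i /= ->; rewrite sr'.
Qed.

Lemma RSK_points_sorted A : all (path leq 0) (RSK_points A).1.
Proof.
elim/last_ind: A => // A [x a]; rewrite /RSK_points foldl_rcons -/(RSK_points A).
case: (RSK_points A) => P Q /= /(tab_insert_sorted x).
by rewrite /RSK_step /=; case: (tab_insert x P).
Qed.

Fixpoint climbs (x : nat) (T : tableau) : bool :=
  if T is r :: T' then has (fun y => (x < y) && climbs y T') r else true.

Lemma climbs_le x y (T : tableau) : x <= y -> climbs y T -> climbs x T.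
Proof.
case: T => //= r T lexy /hasP[z zr /andP[ltyz cz]].
by apply/hasP; exists z => //; rewrite cz andbT (leq_ltn_trans lexy).
Qed.

Lemma find_gt_min x (z : nat) (r : seq nat) :
  path leq 0 r -> z \in r -> x < z -> nth 0 r (find (ltn x) r) <= z.
Proof.
elim: r => //= y r IHr yr zr ltxz; case: ifP => [ltxy|ltxy] /=.
  move: yr zr; rewrite (path_sortedE leq_trans) inE => /andP[/allP ler _].
  by case/predU1P=> [->//|/ler].
apply: IHr => //; last by case/predU1P: zr => // eqzy; rewrite -eqzy ltxz in ltxy.
by move: yr; rewrite !(path_sortedE leq_trans) => /andP[_ ->]; rewrite all_predT.
Qed.

(** Insertion creates a row iff every row bumps. The bumped entry is the least
one exceeding the incoming entry, so it can replace the entry of any other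
increasing sequence. *)
Lemma tab_insert_size x (T T' : tableau) i :
    all (path leq 0) T -> tab_insert x T = (T', i) ->
  [/\ nrows T' = nrows T + climbs x T
    & ncols T' = ncols T + ~~ has (ltn x) (head [::] T)].
Proof.
elim: T x T' i => [|r T IHT] x T' i /=; first by move=> _ [<- _].
move=> /andP[sr sT]; rewrite row_insertE -has_find.
have [xr|xr] := boolP (has (ltn x) r); last first.
  case=> <- _; rewrite /ncols /nrows /= size_set_nth; split.
    case: hasP => [[y yr /andP[ltxy _]]|]; last by rewrite addn0.
    by case/hasP: xr; exists y.
  by rewrite hasNfind // addn1; apply/maxn_idPl.
set y := nth 0 r _; case def_T1: (tab_insert y T) => [T1 i1] [<- _].
have [rowsT1 _] := IHT y T1 i1 sT def_T1.
rewrite /nrows /ncols /= -/(nrows T1) rowsT1 addn0 addSn; split; last first.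
  by rewrite size_set_nth; apply/maxn_idPr; rewrite -has_find.
congr (_ + nat_of_bool _).+1; apply/idP/hasP => [cy|[z zr /andP[ltxz cz]]].
  exists y; first by rewrite mem_nth // -has_find.
  by rewrite cy andbT; apply: (nth_find 0 xr).
exact: climbs_le (find_gt_min sr zr ltxz) cz.
Qed.

Lemma has_increasing_chain_climbs r (T : tableau) c :
  has_increasing_chain (r :: T) c (size T).+1 <->
  0 < c <= size r /\ climbs (nth 0 r c.-1) T.
Proof.
elim: T r c => [|r' T IHT] r c.
  split=> [[j [<- cell _]]|[ltc _]]; first by have := cell 1 isT.
  by exists (fun=> c); split=> // [[|[|i]]|[|[|i]]].
split=> [[j [<- cell inc]]|[ltc /hasP[y yr' /andP[lty cy]]]].
  split; first by have := cell 1 isT.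
  have [ltj cj] : 0 < j 2 <= size r' /\ climbs (nth 0 r' (j 2).-1) T.
    apply/IHT; exists (fun i => j i.+1); split=> // [[|i]|[|i]] //.
      by move=> lti; have := cell i.+2 lti.
    by move=> lti; have := inc i.+2 lti.
  apply/hasP; exists (nth 0 r' (j 2).-1); last by apply/andP; split; [apply: (inc 1)|].
  by rewrite mem_nth //; case: (j 2) ltj.
have [|j [j1 cell inc]] := (IHT r' (index y r').+1).2.
  by rewrite /= index_mem nth_index.
exists (fun i => if i == 1 then c else j i.-1).
split=> // [[|[|i]]|[|[|i]]] //.
- by move=> lti; have := cell i.+1 lti.
- by move=> _; rewrite /= j1 /entry /= nth_index.
- by move=> lti; have := inc i.+1 lti.
Qed.

(** * Words as sets of points *)
Definition points (w : seq nat) : seq (nat * nat) := zip w (iota 1 (size w)).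

Lemma points_by_time w : uniq w -> by_time (points w).
Proof.
by move=> uw; rewrite /by_time unzip1_zip ?unzip2_zip ?size_iota ?iota_ltn_sorted.
Qed.

Lemma points_rcons w t : points (rcons w t) = rcons (points w) (t, (size w).+1).
Proof.
rewrite /points size_rcons -[X in iota 1 X]addn1 iotaD cats1 zip_rcons ?size_iota //.
Qed.

Lemma points_map f w : points (map f w) = [seq (f p.1, p.2) | p <- points w].
Proof.
rewrite /points size_map; elim: w 1 => //= x w IHw i; by rewrite IHw.
Qed.

(** Conversely, a chain sorted by time in the points of a word is the filtered
list of these points, hence comes from a subword. *)
Lemma subseq_chain (r : rel nat) m w :
  (exists s, [/\ subseq s w, size s = m & sorted r s]) <->
  has_chain (fun p q => r p.1 q.1 && (p.2 < q.2)) m (points w).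
Proof.
have sort_pts : sorted ltn (unzip2 (points w)).
  by rewrite unzip2_zip ?size_iota ?iota_ltn_sorted.
have def_w : w = unzip1 (points w) by rewrite unzip1_zip ?size_iota.
move: (points w) sort_pts def_w => A sA ->.
have rP s : sorted (fun p q => r p.1 q.1 && (p.2 < q.2)) s =
    sorted r (unzip1 s) && sorted ltn (unzip2 s).
  by rewrite !sorted_map -sorted_relI.
split=> [[s [/subseqP[b szb ->] sz ss]]|[s [sub sz]]].
  exists (mask b A); rewrite rP; split.
  - by move=> p /mem_mask.
  - by rewrite -sz /unzip1 -map_mask size_map.
  rewrite {1}/unzip1 map_mask ss /=; apply: (subseq_sorted ltn_trans _ sA).
  exact: map_subseq (mask_subseq _ _).
rewrite rP => /andP[ss1 ss2]; exists (unzip1 s); rewrite size_map; split=> //.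
suff -> : s = [seq p <- A | p \in s] by apply: map_subseq; apply: filter_subseq.
apply: (@irr_sorted_eq _ (relpre snd ltn)).
- by move=> p q z /=; apply: ltn_trans.
- by move=> p /=; rewrite ltnn.
- by rewrite -sorted_map.
- rewrite -sorted_map; apply: (subseq_sorted ltn_trans _ sA).
  exact: map_subseq (filter_subseq _ _).
by move=> p; rewrite mem_filter; case: (boolP (p \in s)) => // /sub ->.
Qed.

Lemma contains_incP m w : contains_inc m w <-> has_chain ascends m (points w).
Proof. exact: (subseq_chain ltn). Qed.

Lemma contains_decP m w : contains_dec m w <-> has_chain descends m (points w).
Proof. exact: (subseq_chain gtn). Qed.

Lemma schensted_inc m w :
  uniq w -> contains_inc m w <-> m <= ncols (RSK w).1.
Proof.
move=> uw; apply: iff_trans (contains_incP m w) _.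
exact: ascending_chain_ncols (points_by_time uw).
Qed.

Lemma schensted_dec m w :
  uniq w -> contains_dec m w <-> m <= nrows (RSK w).1.
Proof.
move=> uw; apply: iff_trans (contains_decP m w) _.
exact: descending_chain_nrows (points_by_time uw).
Qed.

(** * Extensions to the right *)
Lemma shift_from_mono t : {mono shift_from t : a b / a < b}.
Proof. by move=> a b; rewrite /shift_from; do 2?case: ifP; lia. Qed.

Lemma climbs_map f x (T : tableau) :
  {mono f : a b / a < b} -> climbs (f x) (map (map f) T) = climbs x T.
Proof.
move=> f_mono; elim: T x => //= r T IHT x; rewrite has_map.
by apply: eq_has => y /=; rewrite f_mono IHT.
Qed.

Lemma shift_from_gt u y : (u.+1 < shift_from u.+1 y) = (u < y).
Proof. by rewrite /shift_from; case: ifP; lia. Qed.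

Lemma ext_right_uniq w t : uniq w -> uniq (ext_right w t).
Proof.
move=> uw; rewrite rcons_uniq map_inj_uniq ?uw ?andbT.
  by apply/mapP=> [[x _]]; rewrite /shift_from; case: ifP; lia.
by move=> a b; rewrite /shift_from; do 2?case: ifP; lia.
Qed.

(** A shifted entry exceeds u + 1 iff the original entry exceeds u, so inserting
the letter u + 1 in the shifted tableau amounts to comparing with u in P. *)
Lemma ext_right_size w u (P := (RSK w).1) :
  nrows (RSK (ext_right w u.+1)).1 = nrows P + climbs u P /\
  ncols (RSK (ext_right w u.+1)).1 = ncols P + ~~ has (ltn u) (head [::] P).
Proof.
rewrite /RSK -/(points (ext_right w u.+1)) /ext_right points_rcons points_map.
rewrite -/(RSK_points _) /RSK_points foldl_rcons -/(RSK_points _).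
rewrite RSK_points_map; last exact: shift_from_mono.
have -> : (RSK_points (points w)).1 = P by [].
have sP : all (path leq 0) P := RSK_points_sorted (points w).
set f := shift_from u.+1; rewrite /RSK_step /=.
case def_T: (tab_insert u.+1 (map (map f) P)) => [T i] /=.
have sfP : all (path leq 0) (map (map f) P).
  apply/allP=> _ /mapP[r rP ->]; have := allP sP r rP.
  rewrite !(path_sortedE leq_trans) => /andP[_ sr]; rewrite all_predT sorted_map /=.
  apply: sub_sorted sr => a b /=; rewrite /f /shift_from; do 2?case: ifP; lia.
have [-> ->] := tab_insert_size sfP def_T.
rewrite /nrows size_map; case: P sP {sfP def_T} => [|r P] //= _; rewrite !has_map.
split; congr (_ + nat_of_bool _).
  by apply: eq_has => y /=; rewrite shift_from_gt climbs_map //; apply: shift_from_mono.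
  by rewrite /ncols /= size_map.
by congr (~~ _); apply: eq_has => y /=; rewrite shift_from_gt.
Qed.

Lemma first_row_values w :
    uniq w -> w != [::] ->
  exists r T, [/\ (RSK w).1 = r :: T, r != [::] & {subset r <= w}].
Proof.
move=> uw w_neq0; have bt := points_by_time uw.
have A_neq0 : points w != [::] by case: w w_neq0 {uw bt}.
case def_st: (row_scan (points w)) => [[R S] K].
have [c [_ [ltR minR] _ _]] := row_scan_shadow bt def_st.
exists R, (RSK_points K).1; rewrite /RSK -/(points w) -/(RSK_points _).
rewrite (RSK_points_cons def_st) //; split=> //.
  case: (points w) A_neq0 ltR => // p A _ /(_ p (mem_head _ _)).
  by case: R {minR def_st}.
move=> y /(nthP 0)[j ltj <-]; have [p pA [_ <- _]] := minR j ltj.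
have -> : w = unzip1 (points w) by rewrite unzip1_zip ?size_iota.
exact: map_f.
Qed.

Definition right_crucial (k l : nat) (w : seq nat) : Prop :=
  [/\ ~ contains_inc k w, ~ contains_dec l w
    & forall t, 1 <= t <= (size w).+1 ->
        contains_inc k (ext_right w t) \/ contains_dec l (ext_right w t)].

(** The letter t = u + 1 is tested for u = size w, which cannot create a row, for
u = 0, which cannot create a column, and for u + 1 = p, the last entry of the
first row, the hardest letter that does not create a column. *)
Lemma right_crucialP k l w :
    0 < k -> 0 < l -> uniq w -> w != [::] -> {in w, forall x, 1 <= x <= size w} ->
  right_crucial k l w <->
  [/\ ncols (RSK w).1 = k - 1, nrows (RSK w).1 = l - 1
    & has_increasing_chain (RSK w).1 (k - 1) (l - 1)].
Proof.
move=> k_gt0 l_gt0 uw w_neq0 w_range.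
have ext u : contains_inc k (ext_right w u.+1) \/ contains_dec l (ext_right w u.+1)
  <-> k <= ncols (RSK w).1 + ~~ has (ltn u) (head [::] (RSK w).1) \/
      l <= nrows (RSK w).1 + climbs u (RSK w).1.
  have [<- <-] := ext_right_size w u; have uwu := ext_right_uniq u.+1 uw.
  by split=> [[/(schensted_inc _ uwu)|/(schensted_dec _ uwu)]|
    [/(schensted_inc _ uwu)|/(schensted_dec _ uwu)]]; [left|right|left|right].
have := RSK_points_sorted (points w).
have -> : (RSK_points (points w)).1 = (RSK w).1 by [].
have incP := schensted_inc k uw; have decP := schensted_dec l uw.
have [r [T [eP r_neq0 rw]]] := first_row_values uw w_neq0.
rewrite /right_crucial; rewrite {}eP in ext incP decP *.
move=> /andP[sr _]; rewrite /nrows /ncols /= in ext incP decP *.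
have r_range y : y \in r -> 1 <= y <= size w by move=> /rw/w_range.
have ltr : 0 < size r by case: r r_neq0 {ext incP decP sr rw r_range}.
set p := nth 0 r (size r).-1.
have pr : p \in r by rewrite mem_nth // prednK.
have lep y : y \in r -> y <= p.
  move=> yr; rewrite -(nth_index 0 yr).
  move: sr; rewrite (path_sortedE leq_trans) => /andP[_ sr].
  apply: (sorted_leq_nth leq_trans leqnn 0 sr); rewrite ?inE ?index_mem ?prednK //.
  by rewrite -ltnS prednK // index_mem.
split=> [[ninc ndec crucial]|[eqk eql chain]].
  have {}ninc : size r < k by rewrite ltnNge; apply/negP=> /incP.
  have {}ndec : (size T).+1 < l by rewrite ltnNge; apply/negP=> /decP.
  have H u : u <= size w -> k <= size r + ~~ has (ltn u) r \/
      l <= (size T).+1 + has (fun y => (u < y) && climbs y T) r.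
    by move=> leu; apply/ext/crucial.
  have eqk : size r = k - 1.
    have [|] := H (size w) (leqnn _); first by lia.
    case: hasP => [[y /r_range/andP[_ ley] /andP[]]|]; lia.
  have eql : (size T).+1 = l - 1.
    have [|] := H 0 (leq0n _); last by lia.
    have -> : has (ltn 0) r; last by lia.
    by apply/hasP; exists p => //; case/andP: (r_range p pr).
  split=> //; rewrite -eqk -eql; apply/has_increasing_chain_climbs.
  rewrite ltr leqnn -/p; split=> //.
  have /andP[p_gt0 lepw] := r_range p pr.
  (* an entry exceeding p - 1 in the first row can only be p *)
  have [||] := H p.-1; first by lia.
    have -> : has (ltn p.-1) r by apply/hasP; exists p => //=; lia.
    lia.
  case: hasP => [[y yr /andP[lty cy]]|]; last by lia.
  by have <- : y = p by have := lep y yr; lia.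
split; [by move/incP; lia|by move/decP; lia|].
move=> [//|u] _; apply/ext.
move: chain; rewrite -eqk -eql => /has_increasing_chain_climbs[_]; rewrite -/p => cp.
have [ltup|lepu] := ltnP u p.
  right; have -> : has (fun y => (u < y) && climbs y T) r; last by lia.
  by apply/hasP; exists p; rewrite ?ltup.
left; have -> : has (ltn u) r = false; last by lia.
by apply/hasP=> [[y /lep ley /= ltuy]]; lia.
Qed.

(** * Extensions from above and the inverse permutation *)
Lemma has_ascending_chain_swap A A' m :
  A' =i map swap A -> has_chain ascends m A -> has_chain ascends m A'.
Proof.
move=> eqA [s [sA sz ss]]; exists (map swap s); split; rewrite ?size_map //.
  by move=> p; rewrite eqA !mem_swap => /sA.
by rewrite sorted_map; apply: sub_sorted ss => p q; rewrite -ascends_swap.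
Qed.

(** The exchange reverses descending chains. *)
Lemma has_descending_chain_swap A A' m :
  A' =i map swap A -> has_chain descends m A -> has_chain descends m A'.
Proof.
move=> eqA [s [sA sz ss]]; exists (rev (map swap s)).
split; rewrite ?size_rev ?size_map //.
  by move=> p; rewrite mem_rev eqA !mem_swap => /sA.
rewrite rev_sorted sorted_map; apply: sub_sorted ss => p q.
by rewrite /descends /swap /= andbC.
Qed.

Lemma eq_mem_swap A A' : A' =i map swap A -> A =i map swap A'.
Proof. by move=> eqA p; rewrite mem_swap eqA mem_swap swapK. Qed.

Lemma contains_inc_swap m w w' :
  points w' =i map swap (points w) -> contains_inc m w <-> contains_inc m w'.
Proof.
move=> eqw; split=> /contains_incP H; apply/contains_incP; move: H.
  exact: has_ascending_chain_swap.
exact: has_ascending_chain_swap (eq_mem_swap eqw).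
Qed.

Lemma contains_dec_swap m w w' :
  points w' =i map swap (points w) -> contains_dec m w <-> contains_dec m w'.
Proof.
move=> eqw; split=> /contains_decP H; apply/contains_decP; move: H.
  exact: has_descending_chain_swap.
exact: has_descending_chain_swap (eq_mem_swap eqw).
Qed.

Lemma points_ext_above w u :
  u <= size w ->
  points (ext_above w u.+1) =i
    ((size w).+1, u.+1) :: [seq (p.1, shift_from u.+1 p.2) | p <- points w].
Proof.
move=> leu p; rewrite /ext_above /=.
have szt : size (take u w) = u by rewrite size_takel.
have szd : size (drop u w) = size w - u by rewrite size_drop.
have -> : points w = zip (take u w) (iota 1 u) ++ zip (drop u w) (iota u.+1 (size w - u)).
  by rewrite -zip_cat ?size_iota // -add1n -iotaD subnKC // cat_take_drop.
rewrite /points size_cat /= szt szd iotaD zip_cat ?size_iota // map_cat.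
rewrite /= !mem_cat !inE add1n !mem_cat.
rewrite orbCA; congr [|| _, _ | _].
  congr (p \in _); rewrite -[LHS]map_id; apply/eq_in_map => q.
  move=> /(map_f snd); rewrite -/(unzip2 _) unzip2_zip ?size_iota ?szt //.
  by rewrite mem_iota /shift_from; case: q => a b /=; case: ifP => // ; lia.
congr (p \in _).
move: (drop u w) (size w - u) szd => v _ <-.
suff H i : u < i -> zip v (iota i.+1 (size v)) =
    [seq (q.1, shift_from u.+1 q.2) | q <- zip v (iota i (size v))] by apply: H.
elim: v i => //= x v IHv i ltui; rewrite -IHv; last exact: ltnW.
by rewrite /shift_from ifN // -leqNgt.
Qed.

Lemma points_ext_swap w w' u :
    size w' = size w -> u <= size w -> points w' =i map swap (points w) ->
  points (ext_right w' u.+1) =i map swap (points (ext_above w u.+1)).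
Proof.
move=> szw leu eqw p; rewrite mem_swap points_ext_above // points_rcons size_map.
rewrite points_map mem_rcons !inE szw; congr (_ || _).
  by rewrite -[RHS](inj_eq (inv_inj swapK)) swapK.
apply/mapP/mapP => [[q]|[q qw e]].
  by rewrite eqw mem_swap => qw ->; exists (swap q).
exists (swap q); first by rewrite eqw mem_swap swapK.
by rewrite -[p]swapK e.
Qed.

Lemma points_one_line n (sigma : 'S_n) :
  points (one_line sigma) = [seq ((val (sigma i)).+1, (val i).+1) | i <- enum 'I_n].
Proof.
rewrite /points size_map size_enum_ord /one_line -[RHS]zip_map; congr zip.
by rewrite (iotaDl 1 0) -val_enum_ord -map_comp.
Qed.

Lemma points_one_lineV n (sigma : 'S_n) :
  points (one_line sigma^-1) =i map swap (points (one_line sigma)).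
Proof.
move=> p; rewrite mem_swap !points_one_line; apply/mapP/mapP=> [][i _ e].
  by exists ((sigma^-1)%g i); rewrite ?mem_enum // permKV -[p]swapK e.
exists (sigma i); rewrite ?mem_enum // permK -[p]swapK e.
by [].
Qed.

Lemma one_line_uniq n (sigma : 'S_n) : uniq (one_line sigma).
Proof.
rewrite map_inj_uniq ?enum_uniq // => i j [] /val_inj; exact: perm_inj.
Qed.

Lemma size_one_line n (sigma : 'S_n) : size (one_line sigma) = n.
Proof. by rewrite size_map size_enum_ord. Qed.

Lemma one_line_range n (sigma : 'S_n) x : x \in one_line sigma -> 1 <= x <= n.
Proof. by case/mapP=> i _ ->; rewrite /= ltn_ord. Qed.

Lemma RSK_inverse n (sigma : 'S_n) :
  RSK (one_line sigma^-1) = ((RSK (one_line sigma)).2, (RSK (one_line sigma)).1).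
Proof.
by apply: RSK_points_swap (points_one_lineV sigma);
  apply: points_by_time; apply: one_line_uniq.
Qed.

Lemma top_right_crucialP k l n (sigma : 'S_n) :
  top_right_crucial k l sigma <->
  right_crucial k l (one_line sigma) /\ right_crucial k l (one_line sigma^-1).
Proof.
have eqV := points_one_lineV sigma.
have incV := contains_inc_swap k eqV; have decV := contains_dec_swap l eqV.
have szV : size (one_line sigma^-1) = size (one_line sigma) by rewrite !size_one_line.
have above u (leu : u <= n) :
    contains_inc k (ext_above (one_line sigma) u.+1) \/
      contains_dec l (ext_above (one_line sigma) u.+1) <->
    contains_inc k (ext_right (one_line sigma^-1) u.+1) \/
      contains_dec l (ext_right (one_line sigma^-1) u.+1).
  have eq_ext : points (ext_right (one_line sigma^-1) u.+1) =i
      map swap (points (ext_above (one_line sigma) u.+1)).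
    by apply: points_ext_swap; rewrite ?size_one_line.
  have incE := contains_inc_swap k eq_ext; have decE := contains_dec_swap l eq_ext.
  tauto.
rewrite /top_right_crucial /right_crucial !size_one_line.
split=> [[ninc ndec right_ext above_ext]|[[ninc ndec right_ext] [_ _ right_extV]]].
  split; split=> //; [by move/incV|by move/decV|].
  by move=> [//|u] leu; apply/above => //; apply: above_ext.
split=> // [[//|u]] leu; apply/above => //; exact: right_extV.
Qed.

Theorem theorem26 (k l n : nat) (hk : 0 < k) (hl : 0 < l) (hn : 0 < n)
    (sigma : 'S_n) (P Q : tableau) (hPQ : RSK (one_line sigma) = (P, Q)) :
  top_right_crucial k l sigma <->
  [/\ ncols P = k - 1 /\ ncols Q = k - 1,
      nrows P = l - 1 /\ nrows Q = l - 1,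
      has_increasing_chain P (k - 1) (l - 1)
    & has_increasing_chain Q (k - 1) (l - 1)].
Proof.
have rightP (tau : 'S_n) := @right_crucialP k l (one_line tau) hk hl (one_line_uniq tau).
have neq0 (tau : 'S_n) : one_line tau != [::].
  by rewrite -size_eq0 size_one_line -lt0n.
have range (tau : 'S_n) : {in one_line tau, forall x, 1 <= x <= size (one_line tau)}.
  by move=> x; rewrite size_one_line; apply: one_line_range.
have := rightP sigma (neq0 _) (range _).
have := rightP (sigma^-1)%g (neq0 _) (range _).
rewrite RSK_inverse hPQ /= => rightQ rightP'.
apply: iff_trans (top_right_crucialP k l sigma) _.
split=> [[/rightP'[-> -> ?] /rightQ[-> -> ?]]|[[? ?] [? ?] ? ?]] //.
by split; [apply/rightP'|apply/rightQ].
Qed.
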